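(* Let $(X,\tau)$ be a Hausdorff topological vector space over $\mathbb{R}$ which is quasi-point-separable. Then $X$ has the fixed point property: for every nonempty, compact, convex subset $C\subseteq X$ and every $\tau$-continuous mapping $f:C\to C$, there exists $x_0\in C$ with $f(x_0)=x_0$.
   Context: All vector spaces are real; $\theta$ denotes the origin of $X$ and $\mathbb{R}^+=[0,\infty)$. A function $u:X\to\mathbb{R}^+$ is called m-quasiconvex if $u(\theta)=0$ and for all $x_1,x_2\in X$ and $0\le\alpha\le1$ one has $u(\alpha x_1+(1-\alpha)x_2)\le\max\{u(x_1),u(x_2)\}$. A topological vector space $(X,\tau)$ is called quasi-point-separable if there is a family $\{u_\lambda\}_{\lambda\in\Lambda}$ of $\tau$-continuous m-quasiconvex functions on $X$ such that, for $x\in X$, $u_\lambda(x)=0$ for every $\lambda\in\Lambda$ implies $x=\theta$; such a family is called a quasi-point-separating space for $X$. *)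

(* Defs.v *)
From HB Require Import structures.
From mathcomp Require Import all_boot all_order all_algebra.
From mathcomp Require Import all_classical all_reals all_analysis.
Set Implicit Arguments. Unset Strict Implicit. Unset Printing Implicit Defensive.
Import Order.TTheory GRing.Theory Num.Theory.
Import numFieldNormedType.Exports.
Local Open Scope classical_set_scope.
Local Open Scope ring_scope.

Definition m_quasiconvex (R : realType) (X : lmodType R) (u : X -> R) : Prop :=
  (forall x, 0 <= u x) /\ u 0 = 0 /\
  forall (x1 x2 : X) (a : R), 0 <= a -> a <= 1 ->
    u (a *: x1 + (1 - a) *: x2) <= Num.max (u x1) (u x2).

Definition quasi_point_separable (R : realType) (X : topologicalLmodType R) : Prop :=
  exists (L : Type) (u : L -> X -> R),
    (forall l, continuous (u l)) /\
    (forall l, m_quasiconvex (u l)) /\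
    (forall x : X, (forall l, u l x = 0) -> x = 0).

Definition fixed_point_property (R : realType) (X : topologicalLmodType R) : Prop :=
  forall (C : set X), C !=set0 -> compact C -> convex_set (C : set (convex_lmodType X)) ->
  forall f : X -> X, {within C, continuous f} -> f @` C `<=` C ->
  exists2 x0, C x0 & f x0 = x0.

(* Main.v *)
Require Import Defs.
From HB Require Import structures.
From mathcomp Require Import all_boot zify.

(** Suppose [f] has no fixed point in the compact convex set [C]. By compactness,
    the maximum [v] of finitely many rescaled functions of the separating family
    satisfies [v (f x - x) > 1] on [C]. This contradicts the following: if [u] is
    continuous and m-quasiconvex, then [u (f x - x) < 1] for some [x] in [C].

    For the latter, cover [C] by finitely many sets [{z | u (z - y i) < 1/2}] with
    [y i] in [C], and write [g t] for the sum of the [t i *: y i], where [t] ranges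
    over the standard simplex. The closed sets
    [F i := {t | u (f (g t) - y i) <= 1/2}] cover the simplex, so some [t] lies in
    [F i] whenever [t i > 0]; quasiconvexity of [u] then gives
    [u (f (g t) - g t) <= 1/2].

    Such a point [t] is a cluster point of ever smaller cells of grid points that
    carry all the labels of their (approximate) support. These cells come from
    Scarf's combinatorial lemma, a parity argument that replaces Sperner's lemma
    and needs no triangulation. *)

Set Implicit Arguments. Unset Strict Implicit. Unset Printing Implicit Defensive.

(** * Scarf's lemma *)

Section Scarf.
Variables (I T : finType) (r : I -> T -> nat).
Hypothesis r_inj : forall i, injective (r i).
Implicit Types S : {set T}.

(* Scarf's primitive sets, for the linear orders given by the ranks [r i].
   Those with [#|I|] elements are called rooms, those with one element fewer doors. *)
Definition dominant S :=
  [forall y, exists i, forall x in S, r i y <= r i x].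

Lemma dominantP S :
  reflect (forall y, exists i, forall x, x \in S -> r i y <= r i x) (dominant S).
Proof.
apply: (iffP forallP) => H y; have := H y.
  by case/existsP => i /forall_inP; exists i.
by case=> i Hi; apply/existsP; exists i; apply/forall_inP.
Qed.

Lemma dominantS S1 S2 : S1 \subset S2 -> dominant S2 -> dominant S1.
Proof.
move=> /subsetP s12 /dominantP d2; apply/dominantP => y.
by have [i Hi] := d2 y; exists i => x /s12; apply: Hi.
Qed.

(** For nonempty [S], adding such a point can change the minimum of [S] only for the order [i]. *)
Definition above S i : {set T} :=
  [set y | [forall (k | k != i), exists x in S, r k x < r k y]].

Lemma aboveP S i y :
  reflect (forall k, k != i -> exists2 x, x \in S & r k x < r k y)
          (y \in above S i).
Proof.
rewrite inE; apply: (iffP forall_inP) => H k /H.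
  by case/exists_inP => x; exists x.
by case=> x xS xy; apply/exists_inP; exists x.
Qed.

(** A set rather than a point, so that an empty [above S i] needs no default; otherwise it is a
    singleton. *)
Definition top_above S i : {set T} :=
  [set x in above S i | [forall y in above S i, r i y <= r i x]].

Lemma top_aboveP S i x :
  reflect (x \in above S i /\ forall y, y \in above S i -> r i y <= r i x)
          (x \in top_above S i).
Proof.
apply: (iffP setIdP) => -[xM].
  by move/forall_inP.
by move=> H; split=> //; apply/forall_inP.
Qed.

Lemma card_top_above S i : above S i != set0 -> #|top_above S i| = 1.
Proof.
case/set0Pn => y0 y0M; case: (arg_maxnP (r i) y0M) => x xM xmax.
rewrite (_ : top_above S i = [set x]) ?cards1 //.
apply/setP => z; rewrite in_set1; apply/top_aboveP/eqP => [[zM zmax]|->].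
  by apply: (@r_inj i); apply/eqP; rewrite eqn_leq (zmax x) // andbT; apply: xmax.
by split=> // y /xmax.
Qed.

(** * The rooms that contain a given door *)

Section Door.
Variable S : {set T}.
Hypotheses (domS : dominant S) (cardS : #|S|.+1 = #|I|) (S0 : S != set0).

Lemma door_argmin : {m : I -> T | forall i, m i \in S /\
  forall x, x \in S -> r i (m i) <= r i x}.
Proof.
have /sigW [x0 x0S] : exists x, x \in S by apply/set0Pn.
exists (fun i => [arg min_(x < x0 in S) r i x]) => i.
by case: arg_minnP.
Qed.

(* The minima of [S] for the [#|S|.+1] orders hit every point of [S], so exactly
   two orders [i] and [j] share their minimum. A point that completes [S] becomes
   the minimum for one of these two, and is then determined by maximality. *)
Lemma door_pair : exists i j, [/\ i != j,
  [set x | (x \notin S) && dominant (x |: S)] = top_above S i :|: top_above S j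
  & [disjoint top_above S i & top_above S j]].
Proof.
have [m mP] := door_argmin.
have mS i : m i \in S by case: (mP i).
have mle i x : x \in S -> r i (m i) <= r i x by case: (mP i) => _; apply.
have m_uniq i x : x \in S -> (forall y, y \in S -> r i x <= r i y) -> m i = x.
  move=> xS xle; apply: (@r_inj i); apply/eqP.
  by rewrite eqn_leq mle ?xle.
have m_surj x : x \in S -> exists i, m i = x.
  move=> xS; have /dominantP/(_ x)[i Hi] := domS.
  by exists i; apply: m_uniq.
have imm : [set m i | i : I] = S.
  apply/setP => x; apply/imsetP/idP => [[i _ ->]//|/m_surj[i <-]].
  by exists i.
have [i [j [ij mij]]] : exists i j, i != j /\ m i = m j.
  have /injectivePn[i [j ij mij]] : ~~ injectiveb m.
    apply/negP => /injectiveP m_inj.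
    by move: cardS; rewrite -imm (card_imset _ m_inj) => /esym/n_Sn.
  by exists i, j.
(* The [#|S|] orders left after dropping [k] still attain every point of [S], so their minima are
   distinct. *)
have minj k l : k != l -> m k = m l -> {in [set~ k] &, injective m}.
  move=> kl mkl; apply/imset_injP.
  rewrite cardsC1 (_ : [set m x | x in [set~ k]] = S); first by rewrite -cardS.
  apply/setP => x; apply/imsetP/idP => [[h _ ->]//|/m_surj[h <-]].
  have [->|hk] := eqVneq h k; first by exists l => //; rewrite !inE eq_sym.
  by exists h => //; rewrite !inE.
have inji := minj _ _ ij mij.
have injj : {in [set~ j] &, injective m} by apply: (minj j i); rewrite 1?eq_sym.
have aboveE k y l : y \in above S k -> l != k -> r l (m l) < r l y.
  by move/aboveP => H /H[x xS]; apply: leq_ltn_trans; apply: mle.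
have nabove k y : (forall l, l != k -> r l (m l) < r l y) -> y \in above S k.
  by move=> H; apply/aboveP => l /H; exists (m l).
have room k l x : k != l -> m k = m l -> {in [set~ k] &, injective m} ->
    x \in top_above S k -> (x \notin S) && dominant (x |: S).
  move=> kl mkl inj; case/top_aboveP=> xM xmax.
  have xlt := aboveE _ _ ^~ xM.
  have xS : x \notin S.
    apply/negP => /m_surj[h hx].
    have [hk|hk] := eqVneq h k.
      by have := xlt l; rewrite eq_sym kl => /(_ isT); rewrite -mkl -hk hx ltnn.
    by have := xlt h hk; rewrite hx ltnn.
  have xk y : y \in S -> r k x <= r k y.
    move=> yS; have /dominantP/(_ x)[h Hh] := domS.
    have [<-|hk] := eqVneq h k; first exact: Hh.
    by have := xlt h hk; rewrite ltnNge Hh.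
  rewrite xS; apply/dominantP => y.
  (* For [y] in [above S k] the order [k] works, by maximality of [x]. Any other [y] is below all of
     [S], hence below [x], for some order [h != k]. *)
  have [yM|] := boolP (y \in above S k).
    exists k => z /setU1P[->|zS]; first exact: xmax.
    exact: leq_trans (xmax _ yM) (xk _ zS).
  rewrite inE negb_forall => /existsP[h]; rewrite negb_imply => /andP[hk].
  rewrite negb_exists => /forallP Hh.
  have yle z : z \in S -> r h y <= r h z.
    by move=> zS; have := Hh z; rewrite zS -leqNgt.
  exists h => z /setU1P[->|/yle//].
  by apply: leq_trans (ltnW (xlt h hk)); apply: yle.
exists i, j; split => //.
  apply/setP => x; rewrite inE in_setU; apply/idP/orP; last first.
    by case; [apply: (room i j)|apply: (room j i) => //; rewrite eq_sym].
  case/andP=> xS /dominantP domx.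
  have choose z : z \in x |: S -> exists h, forall y, y \in x |: S -> r h z <= r h y.
    by move=> _; have [h Hh] := domx z; exists h.
  (* [x] is the minimum of [x |: S] for [k0], and every point of [S] remains the minimum for another
     order. This forces [k0] to be [i] or [j]. *)
  have [k0 xk0] := choose x (setU11 _ _).
  have xne z : z \in S -> z != x by move=> zS; apply: contraNneq xS => <-.
  have minz z : z \in S -> exists h, [/\ m h = z, h != k0 & r h z < r h x].
    move=> zS; have [h Hh] := choose z (setU1r _ zS); exists h.
    have mh : m h = z by apply: m_uniq => // y yS; apply: Hh; rewrite setU1r.
    split=> //.
      apply: contra_neq (xne z zS) => hk; apply: (@r_inj h); apply/eqP.
      by rewrite eqn_leq Hh ?setU11 //= hk xk0 // setU1r.
    rewrite ltn_neqAle Hh ?setU11 // andbT.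
    by apply: contra (xne z zS) => /eqP/r_inj ->.
  have fin k : {in [set~ k] &, injective m} -> k0 = k -> x \in top_above S k.
    move=> inj k0k; subst k0; apply/top_aboveP; split.
      apply: nabove => l lk; have [h [mh hk]] := minz (m l) (mS l).
      by rewrite (inj h l) // !inE.
    move=> y yM; have [h Hh] := domx y.
    have [hk|hk] := eqVneq h k; first by rewrite -hk; apply/Hh/setU11.
    by have := aboveE _ _ _ yM hk; rewrite ltnNge Hh // setU1r.
  have [k0i|k0i] := eqVneq k0 i; first by left; apply: fin.
  have [k0j|k0j] := eqVneq k0 j; first by right; apply: fin.
  have [h [mh hk _]] := minz (m k0) (mS k0).
  have hi : h = i.
    apply: contraNeq hk => hi; apply/eqP.
    by apply: inji => //; rewrite !inE.
  have : h == k0; last by rewrite (negbTE hk).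
  by apply/eqP; apply: injj => //; rewrite !inE // hi.
(* A common point would exceed the minimum of [S] for every order, against dominance of [S]. *)
apply/pred0Pn => -[x /andP[/top_aboveP[xi _] /top_aboveP[xj _]]].
have /dominantP/(_ x)[h Hh] := domS.
have : r h (m h) < r h x; last by rewrite ltnNge Hh.
have [hi|hi] := eqVneq h i; last exact: aboveE hi.
by apply: aboveE xj _; rewrite hi.
Qed.
End Door.

(** * Counting facets and cofacets by the point removed or added *)

Lemma card_facets S (P : pred {set T}) : 0 < #|S| ->
  #|[set D : {set T} | [&& #|D|.+1 == #|S|, D \subset S & P D]]| =
  #|[set x in S | P (S :\ x)]|.
Proof.
move=> S_gt0; rewrite -[RHS](card_in_imset (f := fun x => S :\ x)); last first.
  move=> x y; rewrite !inE => /andP[xS _] _ /setP/(_ x).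
  by rewrite !inE eqxx xS andbT /=; case: eqP.
apply: eq_card => D; rewrite inE; apply/and3P/imsetP => [[/eqP cD DS PD]|[x]].
  have /cards1P[x Dx] : #|S :\: D| == 1.
    by rewrite cardsD (setIidPr DS) -cD; apply/eqP; lia.
  have DE : D = S :\ x by rewrite -Dx setDDr setDv set0U; apply/esym/setIidPr.
  have xS : x \in S by have := set11 x; rewrite -Dx inE => /andP[].
  by exists x => //; rewrite inE xS -DE.
by rewrite inE => /andP[xS PD] ->; rewrite subsetDl (cardsD1 x S) xS.
Qed.

Lemma card_cofacets S (P : pred {set T}) :
  #|[set D : {set T} | [&& #|D| == #|S|.+1, S \subset D & P D]]| =
  #|[set x | (x \notin S) && P (x |: S)]|.
Proof.
rewrite -[RHS](card_in_imset (f := fun x => x |: S)); last first.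
  move=> x y; rewrite !inE => /andP[xS _] _ /setP/(_ x).
  by rewrite !inE eqxx (negbTE xS) orbF; case: eqP.
apply: eq_card => D; rewrite inE; apply/and3P/imsetP => [[/eqP cD SD PD]|[x]].
  have /cards1P[x Dx] : #|D :\: S| == 1.
    by rewrite cardsD (setIidPr SD) cD; apply/eqP; lia.
  have DE : D = x |: S by rewrite -Dx setUC -{1}(setIidPr SD) setID.
  have xS : x \notin S by have := set11 x; rewrite -Dx inE => /andP[].
  by exists x => //; rewrite inE xS -DE.
by rewrite inE => /andP[xS PD] ->; rewrite subsetUr cardsU1 xS.
Qed.

(* The slack elements [e i] play the role of the facets of the simplex. *)
Variables (e : I -> T) (c : T -> I).
Hypothesis c_e : forall i, c (e i) = i.
Hypothesis e_min : forall i y, r i (e i) <= r i y.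
Hypothesis e_big : forall i j x, i != j -> x \notin codom e -> r j x < r j (e i).
Hypothesis e_proper : exists x, x \notin codom e.

Let e_inj : injective e. Proof. exact: can_inj c_e. Qed.

Lemma e_ltn i y : y != e i -> r i (e i) < r i y.
Proof.
move=> yi; rewrite ltn_neqAle e_min andbT.
by apply: contra yi => /eqP/r_inj ->.
Qed.

Variable i0 : I.
(** The boundary door: among the doors coloured [[set~ i0]], the only one lying in a single room,
    which makes the final count odd. *)
Let outer : {set T} := e @: [set~ i0].

Lemma outer_colour : c @: outer = [set~ i0].
Proof.
rewrite -imset_comp; apply/setP => i; apply/imsetP/idP => [[j ji ->]|ii].
  by rewrite /= c_e.
by exists i => //=; rewrite c_e.
Qed.

Lemma card_outer : #|outer|.+1 = #|I|.
Proof.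
by rewrite card_imset // cardsC1 prednK //; apply/card_gt0P; exists i0.
Qed.

Lemma outerP x : x \in outer -> exists2 l, l != i0 & x = e l.
Proof. by case/imsetP => l; rewrite !inE; exists l. Qed.

Lemma mem_outer l : l != i0 -> e l \in outer.
Proof. by move=> li; apply: imset_f; rewrite !inE. Qed.

Lemma dominant_outer : dominant outer.
Proof.
apply/dominantP => y; have [/codomP[l ->]|yE] := boolP (y \in codom e).
  by exists l => x _; apply: e_min.
exists i0 => x /outerP[l li ->]; exact/ltnW/e_big.
Qed.

(** The completing point is the largest proper point for [r i0]: an order [k != i0] cannot witness
    dominance at a proper [y], because [e k] is in the set and below [y]. *)
Lemma rooms_of_outer : #|[set x | (x \notin outer) && dominant (x |: outer)]| = 1.
Proof.
have [y0 y0E] := e_proper.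
case: (@arg_maxnP _ y0 [pred x | x \notin codom e] (r i0) y0E) => x /= xE xmax.
rewrite (_ : [set _ | _] = [set x]) ?cards1 //.
apply/setP => z; rewrite !inE; apply/andP/eqP => [[zO /dominantP dz]|->].
  have zi0 y : y \notin codom e -> r i0 y <= r i0 z.
    move=> yE; have [k Hk] := dz y.
    have [<-|ki] := eqVneq k i0; first exact/Hk/setU11.
    have := Hk (e k); rewrite setU1r ?mem_outer // => /(_ isT).
    rewrite leqNgt e_ltn //; apply: contraNneq yE => ->; exact: codom_f.
  have zE : z \notin codom e.
    apply/negP => /codomP[l zl]; move: zO; rewrite zl.
    have [li|/mem_outer->//] := eqVneq l i0.
    move=> _; have := zi0 _ y0E; rewrite zl li leqNgt e_ltn //.
    by apply: contraNneq y0E => ->; exact: codom_f.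
  apply: (@r_inj i0); apply/eqP; rewrite eqn_leq zi0 // andbT; exact: xmax.
split; first by apply: contra xE => /outerP[l _ ->]; apply: codom_f.
apply/dominantP => y; have [/codomP[l ->]|yE] := boolP (y \in codom e).
  by exists l => w _; apply: e_min.
exists i0 => w /setU1P[->|/outerP[l li ->]]; first exact: xmax.
exact/ltnW/e_big.
Qed.

(** Both sets from [door_pair] are singletons, as [e k] lies in [above S k]: otherwise [S] would
    consist of slack elements, and its colours would make it [outer]. *)
Lemma rooms_of_inner S : dominant S -> #|S|.+1 = #|I| -> c @: S = [set~ i0] ->
  S != outer -> #|[set x | (x \notin S) && dominant (x |: S)]| = 2.
Proof.
move=> domS cS colS neS.
have subE : S \subset codom e -> S = outer.
  move=> /subsetP SE; apply/eqP; rewrite eqEcard.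
  have -> : #|outer| <= #|S| by rewrite -ltnS cS card_outer.
  rewrite andbT; apply/subsetP => x xS; have /codomP[l xl] := SE _ xS.
  rewrite xl mem_outer //; have : c x \in [set~ i0] by rewrite -colS imset_f.
  by rewrite !inE xl c_e.
have S0 : S != set0.
  apply: contra_neq neS => S0; apply: subE; rewrite S0.
  by apply/subsetP => x; rewrite inE.
have [i [j [ij -> dis]]] := door_pair domS cS S0.
have ne k : above S k != set0.
  apply/set0Pn; exists (e k); apply/aboveP => l lk.
  have [m [mS mle]] : exists m, m \in S /\ forall x, x \in S -> r l m <= r l x.
    by have [m /(_ l)[]] := door_argmin S0; exists (m l).
  exists m => //; have [/codomP[h mh]|] := boolP (m \in codom e); last first.
    by move=> mE; apply: e_big; rewrite // eq_sym.
  have [hl|hl] := eqVneq h l.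
    by rewrite mh hl e_ltn // (inj_eq e_inj) eq_sym.
  case/eqP: neS; apply: subE; apply/subsetP => x xS.
  by apply: contraT => /(e_big hl); rewrite -mh ltnNge mle.
by rewrite cardsU disjoint_setI0 // cards0 subn0 !card_top_above.
Qed.

(** If removing [x] leaves exactly the colours other than [i0], then [c] is injective on the rest
    and the colour of [x] recurs at a single [x']. Only [x] and [x'] can be removed, so the count is
    0 or 2. *)
Lemma doors_of_room S : #|S| = #|I| -> c @: S != setT ->
  ~~ odd #|[set x in S | c @: (S :\ x) == [set~ i0]]|.
Proof.
move=> cS nfull; set A := [set x in S | _].
have [->|[x xA]] := set_0Vmem A; first by rewrite cards0.
move: (xA); rewrite inE => /andP[xS /eqP cx].
have cardx : #|S :\ x|.+1 = #|I| by rewrite -cS (cardsD1 x S) xS.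
have inj : {in S :\ x &, injective c}.
  by apply/imset_injP; rewrite cx cardsC1 -cardx.
have cxi0 : c x != i0.
  apply: contra nfull => /eqP cxi0; rewrite -(setD1K xS) imsetU1 cx cxi0.
  by rewrite setUCr.
have /imsetP[x' x'S cxx'] : c x \in c @: (S :\ x) by rewrite cx !inE.
have [x'x x'S'] : x' != x /\ x' \in S by move: x'S; rewrite !inE => /andP[].
rewrite (_ : A = [set x; x']) ?cards2 1?eq_sym ?x'x //.
apply/setP => z; rewrite in_set2.
apply/idP/orP; last first.
  case=> /eqP -> //; rewrite inE x'S' -cx; apply/eqP/setP => i.
  apply/imsetP/imsetP => -[w]; rewrite !inE => /andP[w1 w2 ->].
    have [->|wx] := eqVneq w x; first by exists x'; rewrite // !inE x'x.
    by exists w; rewrite // !inE wx.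
  have [->|wx] := eqVneq w x'; first by exists x; rewrite // !inE eq_sym x'x.
  by exists w; rewrite // !inE wx.
rewrite inE => /andP[zS /eqP cz].
have [zx|zx] := eqVneq z x; first by left.
have [zx'|zx'] := eqVneq z x'; first by right.
have zSx : z \in S :\ x by rewrite !inE zx.
have : c z \in c @: (S :\ z) by rewrite cz -cx imset_f.
case/imsetP => w; rewrite !inE => /andP[wz wS] czw.
have [wx|wx] := eqVneq w x.
  by case/eqP: zx'; apply: inj; rewrite // czw wx.
by case/eqP: wz; apply: inj; rewrite // !inE wx.
Qed.

Theorem scarf : exists S, [/\ dominant S, #|S| = #|I| & c @: S = setT].
Proof.
pose rooms := [set S : {set T} | dominant S & #|S| == #|I|].
pose doors := [set D : {set T} | [&& dominant D, #|D|.+1 == #|I| & c @: D == [set~ i0]]].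
have [/exists_inP[S SR /eqP cS]|] :=
  boolP [exists S in rooms, c @: S == setT].
  by exists S; move: SR; rewrite inE => /andP[? /eqP].
rewrite negb_exists_in => /forall_inP nofull.
have I0 : 0 < #|I| by apply/card_gt0P; exists i0.
have outerD : outer \in doors.
  by rewrite inE dominant_outer card_outer outer_colour !eqxx.
(* Incidences are counted twice: by doors the total is odd, since [outer] contributes 1 and every
   other door 2; by rooms it is even if no room has all colours. *)
have count : \sum_(S in rooms) \sum_(D in doors | D \subset S) 1 =
    \sum_(D in doors) \sum_(S in rooms | D \subset S) 1.
  rewrite (exchange_big_dep (mem doors)) /=; last by move=> S D _ /andP[].
  by apply: eq_bigr => D DD; apply: eq_bigl => S; rewrite DD.
have: odd (\sum_(D in doors) \sum_(S in rooms | D \subset S) 1).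
  rewrite (bigD1 outer) //= oddD.
  have cof (D : {set T}) : #|D|.+1 = #|I| ->
      \sum_(S in rooms | D \subset S) 1 =
      #|[set x | (x \notin D) && dominant (x |: D)]|.
    move=> cD; rewrite sum1dep_card -card_cofacets; apply: eq_card => S.
    by rewrite !inE cD; case: dominant; rewrite /= ?andbF ?andbT.
  rewrite cof ?card_outer // rooms_of_outer /=.
  elim/big_ind: _ => // [m n /negbTE om /negbTE on|D].
    by rewrite oddD om on.
  rewrite inE => /andP[/and3P[dD /eqP cD /eqP colD] neD].
  by rewrite cof // rooms_of_inner.
rewrite -count; suff: ~~ odd (\sum_(S in rooms) \sum_(D in doors | D \subset S) 1).
  by move/negbTE->.
elim/big_ind: _ => // [m n /negbTE om /negbTE on|S SR].
  by rewrite oddD om on.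
have := nofull S SR; move: SR; rewrite inE => /andP[dS /eqP cS].
move/(doors_of_room cS); rewrite -(card_facets (fun D => c @: D == [set~ i0])) ?cS //.
rewrite sum1dep_card; congr (~~ odd _); apply: eq_card => D; rewrite !inE.
case: (boolP (D \subset S)) => DS; rewrite ?andbF // andbT /=.
by rewrite (dominantS DS dS).
Qed.
End Scarf.

(** * Small cells in the grid of the simplex *)

(** Comparison of two-digit numbers in base [K] by their leading digits, as in the tie-breaking of
    [grid_rank]. *)
Lemma ltn_digits q q' s K : q < q' -> s < K -> q * K + s < q' * K.
Proof. by move=> qq sK; nia. Qed.

Section Grid.
Variables (I : finType) (N : nat).

Definition grid := {a : {ffun I -> 'I_N.+1} | \sum_k a k == N :> nat}.

Definition grid_coord (a : grid) (i : I) : nat := val a i.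

(* Order by the i-th coordinate, ties being broken by [enum_rank]. *)
Definition grid_rank (i : I) (x : I + grid) : nat :=
  match x with
  | inl j => if j == i then 0 else (1 + N.+1 * #|{: grid}|) + enum_rank j
  | inr a => 1 + (grid_coord a i * #|{: grid}| + enum_rank a)
  end.

(** The offset [1 + N.+1 * #|{: grid}|] exceeds the rank of every grid point. Those ranks start at
    1, leaving 0 to the slack element of the order itself. *)
Lemma grid_rank_inr_lt i j a : i != j -> grid_rank j (inr a) < grid_rank j (inl i).
Proof.
move=> /negbTE ij; rewrite /= ij -addnA ltn_add2l.
apply: leq_trans (leq_addr _ _).
by apply: ltn_digits; exact: ltn_ord.
Qed.

Lemma grid_rank_inj i : injective (grid_rank i).
Proof.
have rl j a : grid_rank i (inl j) <> grid_rank i (inr a).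
  have [->|ji] := eqVneq j i; first by rewrite /= eqxx.
  by move=> E; have := grid_rank_inr_lt a ji; rewrite E ltnn.
move=> [j|a] [k|b]; [|by move/rl|by move/esym/rl|].
  rewrite /=; case: eqP => [->|_]; case: eqP => [->|_] //.
  by move/addnI/ord_inj/enum_rank_inj ->.
move=> /= /addnI /(congr1 (modn^~ #|{: grid}|)).
by rewrite !modnMDl !modn_small // => /ord_inj/enum_rank_inj ->.
Qed.

Lemma grid_sumD1 (a : grid) k : grid_coord a k + \sum_(i | i != k) grid_coord a i = N.
Proof. by have /eqP := valP a; rewrite (bigD1 k). Qed.

Lemma grid_exists (C : {set I}) (m : I -> nat) : C != set0 ->
  \sum_(i in C) m i <= N -> exists a : grid, forall i, i \in C -> m i <= grid_coord a i.
Proof.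
case/set0Pn => k1 k1C mN.
(* The surplus over the prescribed lower bounds goes to the single coordinate [k1], so that the
   total is exactly [N]. *)
pose b k := if k \in C then m k + (k == k1) * (N - \sum_(i in C) m i) else 0.
have sumb : \sum_k b k = N.
  rewrite -big_mkcond big_split /= [X in _ + X](bigD1 k1) //=.
  rewrite eqxx mul1n [X in _ + (_ + X)]big1 => [|k /andP[_ /negbTE->]//].
  by rewrite addn0 subnKC.
have bN k : b k < N.+1 by rewrite ltnS -[leqRHS]sumb (bigD1 k) //= leq_addr.
pose a := [ffun k => Ordinal (bN k)].
have aP : \sum_k a k == N :> nat.
  by rewrite -[X in _ == X]sumb; apply/eqP/eq_bigr => k _; rewrite ffunE.
exists (exist _ a aP) => i iC; rewrite /grid_coord /= ffunE /= /b iC; exact: leq_addr.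
Qed.

(** Take a fully coloured Scarf room; [C] collects the indices whose slack element is not in it.
    Dominance makes the minimal coordinates over [C] add up to nearly [N], which leaves little room
    for variation. *)
Lemma small_cell (i0 : I) (lab : grid -> I) :
  exists (C : {set I}) (p : I -> grid), [/\ C != set0,
    forall i, i \in C -> lab (p i) = i,
    forall i j k, i \in C -> j \in C -> grid_coord (p i) k <= grid_coord (p j) k + #|I| &
    forall i k, i \in C -> k \notin C -> grid_coord (p i) k <= #|I|].
Proof.
have [a0 _] : exists a : grid, forall i, i \in [set i0] -> 0 <= grid_coord a i.
  apply: (@grid_exists _ (fun=> 0)); last by rewrite big1.
  by apply/set0Pn; exists i0; rewrite set11.
pose c (x : I + grid) := match x with inl i => i | inr a => lab a end.
have inrE a : inr a \notin codom (@inl I grid) by apply/negP => /codomP[].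
have [S [domS _ colS]] : exists S, [/\ dominant grid_rank S, #|S| = #|I| &
    c @: S = setT].
  apply: (scarf grid_rank_inj (e := inl) (c := c)) => //.
  - by move=> i y; rewrite /= eqxx.
  - move=> i j [k _ /negP[]|a ij _]; first exact: codom_f.
    exact: grid_rank_inr_lt.
  - by exists (inr a0).
pose C := [set i | inl i \notin S].
have pick i : exists a, i \in C -> inr a \in S /\ lab a = i.
  have /imsetP[[j|a] xS ci] : i \in c @: S by rewrite colS.
    by exists a0; rewrite inE {1}ci xS.
  by exists a.
have [p pP] := fin_all_exists pick.
have pS i : i \in C -> inr (p i) \in S by case/pP.
(* For [i] outside [C] the room contains [inl i], of rank 0 for [i], below every grid point. *)
have dom_inr (y : grid) : exists2 i, i \in C &
    forall x, x \in S -> grid_rank i (inr y) <= grid_rank i x.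
  have /dominantP/(_ (inr y))[i Hi] := domS; exists i => //.
  by rewrite inE; apply/negP => /Hi; rewrite /= eqxx.
have C0 : C != set0 by have [i iC _] := dom_inr a0; apply/set0Pn; exists i.
have min_coord i : exists mu : nat, i \in C ->
    (exists2 a, inr a \in S & grid_coord a i = mu :> nat) /\
    forall a, inr a \in S -> mu <= grid_coord a i.
  have [iC|] := boolP (i \in C); last by exists 0.
  case: (@arg_minnP _ (p i) [pred a | inr a \in S] (fun a => grid_coord a i) (pS i iC)).
  move=> a aS amin; exists (grid_coord a i) => _; split; first by exists a.
  by move=> b; apply: amin.
have [mu muP] := fin_all_exists min_coord.
(* Otherwise some grid point would have all its coordinates in [C] above the minima [mu], against
   dominance. *)
have sum_mu : N < \sum_(i in C) mu i + #|C|.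
  rewrite -sum1_card -big_split /= ltnNge; apply/negP => /(grid_exists C0)[b bP].
  have [i iC Hi] := dom_inr b; have [[a aS ai] _] := muP i iC.
  have := Hi _ aS; rewrite /= leq_add2l leqNgt => /negP; apply.
  apply: leq_trans (leq_addr _ _); apply: ltn_digits => //.
  by have := bP i iC; rewrite -ai addn1.
have CI : #|C| <= #|I| by exact: max_card.
(* The coordinates in [C] other than [k] are at least [mu], so the fixed total [N] bounds the one at
   [k]. *)
have bound_in a k : inr a \in S -> k \in C -> grid_coord a k < mu k + #|C|.
  move=> aS kC; move: sum_mu; rewrite (bigD1 k) //= => lt1.
  have sa := grid_sumD1 a k.
  have : \sum_(i in C | i != k) mu i <= \sum_(i | i != k) grid_coord a i.
    rewrite [leqRHS](bigID (mem C)) /=; apply: leq_trans (leq_addr _ _).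
    rewrite [leqRHS](eq_bigl (fun i => (i \in C) && (i != k))); last first.
      by move=> i; rewrite andbC.
    by apply: leq_sum => i /andP[iC _]; case: (muP i iC) => _; apply.
  by lia.
have bound_out a k : inr a \in S -> k \notin C -> grid_coord a k < #|C|.
  move=> aS kC; have sa := grid_sumD1 a k.
  have : \sum_(i in C) mu i <= \sum_(i | i != k) grid_coord a i.
    rewrite [leqRHS](bigID (mem C)) /=; apply: leq_trans (leq_addr _ _).
    rewrite [leqRHS](eq_bigl (mem C)); last first.
      by move=> i /=; case: eqVneq => // ->; rewrite (negbTE kC).
    by apply: leq_sum => i iC; case: (muP i iC) => _; apply.
  by lia.
exists C, p; split=> //.
- by move=> i /pP[].
- move=> i j k iC jC; have [kC|kC] := boolP (k \in C).
    have := bound_in _ _ (pS i iC) kC; have [_ /(_ _ (pS j jC))] := muP k kC.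
    by lia.
  have := bound_out _ _ (pS i iC) kC; lia.
- by move=> i k iC kC; have := bound_out _ _ (pS i iC) kC; lia.
Qed.

End Grid.

From mathcomp Require Import all_order all_algebra finmap.
From mathcomp Require Import all_classical all_reals all_analysis.
From mathcomp Require Import ring lra.
Import Order.TTheory GRing.Theory Num.Theory.
Import numFieldNormedType.Exports.
Local Open Scope classical_set_scope.
Local Open Scope ring_scope.

(** * Closed covers of the simplex *)

Section KKM.
Variables (R : realType) (n : nat).
Local Notation vec := 'rV[R]_n.+1.

Definition simplex : set vec :=
  [set t | (forall i, 0 <= t ord0 i) /\ \sum_i t ord0 i = 1].

Lemma simplex_le1 t i : simplex t -> t ord0 i <= 1.
Proof.
move=> [t0 <-]; rewrite (bigD1 i) //= lerDl; apply: sumr_ge0 => k _; exact: t0.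
Qed.

Lemma closed_simplex : closed simplex.
Proof.
have -> : simplex = (\bigcap_i [set t : vec | 0 <= t ord0 i]) `&`
    [set t | \sum_i t ord0 i = 1].
  apply/seteqP; split => [t [t0 t1]|t [t0 t1]]; split => // i; last exact: t0.
  by move=> _; exact: t0.
apply: closedI.
  apply: closed_bigI => i _.
  apply: (@preimage_closed _ _ (fun t : vec => t ord0 i) [set x | 0 <= x]).
    by move=> t _; exact: coord_continuous.
  exact: closed_ge.
apply: (@preimage_closed _ _ (fun t : vec => \sum_i t ord0 i) [set 1]).
  move=> t _; move: t; apply: continuous_big => [|i _]; first exact: add_continuous.
  exact: coord_continuous.
exact: closed_eq.
Qed.

Lemma compact_simplex : compact simplex.
Proof.
apply: bounded_closed_compact closed_simplex.
exists 1; split => // M M1 t tS; rewrite /Num.norm /= mx_normrE.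
apply: bigmax_le => [|[j i] _]; first by lra.
rewrite ord1 ger0_norm /=; first by apply: le_trans (ltW M1); exact: simplex_le1.
by case: tS.
Qed.

Definition grid_point N (a : grid 'I_n.+1 N) : vec :=
  \row_i ((grid_coord a i)%:R / N%:R).

Lemma grid_point_simplex N (a : grid 'I_n.+1 N) : (0 < N)%N -> simplex (grid_point a).
Proof.
move=> N0; split => [i|]; first by rewrite mxE divr_ge0.
under eq_bigr do rewrite mxE.
rewrite -mulr_suml -natr_sum.
have /eqP -> : (\sum_i grid_coord a i)%N == N by exact: (valP a).
by rewrite divff // pnatr_eq0 -lt0n.
Qed.

Variable F : 'I_n.+1 -> set vec.
Hypothesis F_closed : forall i, closed (F i).
Hypothesis F_cover : forall t, simplex t -> exists i, F i t.

Lemma approx_cell (eps : R) : 0 < eps -> exists2 x, simplex x &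
  forall i, eps < x ord0 i -> exists2 y, F i y &
    forall k, `|x ord0 k - y ord0 k| <= eps.
Proof.
(* Coordinates within a cell differ by at most [n.+1] grid steps, so [N] is chosen to make
   [n.+1%:R / N%:R] at most [eps]. *)
move=> eps0; pose N := (Num.bound (n.+1%:R / eps)).+1.
have N0 : (0 : R) < N%:R by rewrite ltr0n.
have NE : n.+1%:R / N%:R <= eps.
  rewrite ler_pdivrMr // mulrC -ler_pdivrMr //.
  apply/ltW/(lt_le_trans (archi_boundP _)); first by rewrite divr_ge0 // ltW.
  by rewrite ler_nat.
have le_eps (a b : nat) : (a <= b + n.+1)%N -> a%:R / N%:R - b%:R / N%:R <= eps.
  move=> ab; apply: le_trans NE; rewrite -mulrBl ler_pM2r ?invr_gt0 //.
  by rewrite lerBlDl -natrD ler_nat.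
have /choice[lab labP] (a : grid 'I_n.+1 N) : exists i, F i (grid_point a).
  exact/F_cover/grid_point_simplex.
have [C [p [/set0Pn[j jC] pl pd pb]]] := small_cell ord0 lab.
rewrite card_ord in pd pb.
exists (grid_point (p j)); first exact: grid_point_simplex.
move=> i; rewrite mxE => ei.
(* Coordinates outside [C] are at most [n.+1] steps, hence at most [eps]. *)
have iC : i \in C.
  apply: contraTT ei => iC; rewrite -leNgt.
  have := le_eps _ 0%N (pb j i jC iC); rewrite mul0r subr0; exact.
exists (grid_point (p i)); first by rewrite -[X in F X](pl i iC); exact: labP.
move=> k; by rewrite !mxE ler_norml lerNl opprB !le_eps ?pd.
Qed.

(* A KKM-type theorem with no condition on the boundary: instead of a common
   point of all the [F i], one finds a point in [F i] for each [i] in its support. *)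
Theorem closed_cover_simplex : exists2 t, simplex t & forall i, 0 < t ord0 i -> F i t.
Proof.
have eps_gt0 (N : nat) : (0 : R) < N.+1%:R^-1 by rewrite invr_gt0 ltr0n.
have /choice[x xP] (N : nat) : exists x, simplex x /\
    forall i, N.+1%:R^-1 < x ord0 i -> exists2 y, F i y &
    forall k, `|x ord0 k - y ord0 k| <= N.+1%:R^-1.
  by have [x xS xP] := approx_cell (eps_gt0 N); exists x.
have [t [tS tcl]] : simplex `&` cluster (x @ \oo) !=set0.
  apply: compact_simplex; exists 0%N => // N _; by case: (xP N).
exists t => // i ti; apply: contrapT => nF.
have /nbhs_ballP[e /= e0 eF] : nbhs t (~` F i).
  by apply: open_nbhs_nbhs; split => //; exact/closed_openC.
(* With [x N] within [d] of [t] and [N.+1%:R^-1 < d], the bound by [t ord0 i] gives [x N] a large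
   enough coordinate [i], and the bound by [e] keeps the nearby point of [F i] inside a ball that
   avoids [F i]. *)
have [d [d0 de dt]] : exists d : R, [/\ 0 < d, d + d <= e & d + d <= t ord0 i].
  exists (Num.min e (t ord0 i) / 2); split.
  - by rewrite divr_gt0 // lt_min ti andbT.
  - by rewrite -splitr ge_min lexx.
  - by rewrite -splitr ge_min lexx orbT.
have [N0 _ N0P] := near_infty_natSinv_lt (PosNum d0).
have [||_ [[N NN0 <-] [_ xB]]] := tcl [set x N | N in [set N | (N0 <= N)%N]] (ball t d).
- by exists N0 => // N NN0; exists N.
- exact: nbhsx_ballx.
have Nd : N.+1%:R^-1 < d by exact: N0P.
have xt k : `|t ord0 k - x N ord0 k| < d by exact: xB.
have [|y Fy yx] := (xP N).2 i.
  by have := xt i; rewrite ltr_norml => /andP[_ h]; apply: lt_trans Nd _; lra.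
apply: (eF y) => //; split => // j k; rewrite (ord1 j).
rewrite /ball /=.
have := xt k; have := le_trans (yx k) (ltW Nd).
rewrite !(ltr_norml, ler_norml) => /andP[h1 h2] /andP[h3 h4].
by apply/andP; split; lra.
Qed.
End KKM.

(** * Convex combinations and m-quasiconvex functions *)

(** A point of [A] serves as the base point of the pointed space to which [compact_cover]
    applies. *)
Lemma compact_cover_compact (T : topologicalType) (A : set T) :
  A !=set0 -> compact A -> cover_compact A.
Proof.
move=> [x0 _] cA; pose pT : ptopologicalType := HB.pack T (isPointed.Build T x0).
change (@cover_compact pT A); rewrite -compact_cover; exact: cA.
Qed.

Section Convex.
Variables (R : realType) (X : lmodType R) (P : set X).
Hypothesis P_conv : forall x y (a : R), 0 <= a -> a <= 1 -> P x -> P y ->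
  P (a *: x + (1 - a) *: y).

(** Dividing by the total weight lets the induction pass to the tail, whose weights no longer sum to
    1. *)
Lemma conv_comb_seq (I : eqType) (s : seq I) (t : I -> R) (y : I -> X) :
  (forall i, 0 <= t i) -> (forall i, 0 < t i -> P (y i)) ->
  0 < \sum_(i <- s) t i ->
  P ((\sum_(i <- s) t i)^-1 *: \sum_(i <- s) t i *: y i).
Proof.
move=> t0 Py; elim: s => [|i s IH]; first by rewrite big_nil ltxx.
rewrite !big_cons => sum_gt0.
have := t0 i; rewrite le_eqVlt => /predU1P[ti0|ti0].
  by move: sum_gt0; rewrite -ti0 !add0r scale0r add0r; exact: IH.
have := sumr_ge0 s (P := predT) (fun i _ => t0 i).
set A := \sum_(j <- s) t j in IH sum_gt0 *; rewrite le_eqVlt => /predU1P[A0|A0].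
  rewrite big1_seq ?addr0 -?A0 ?addr0 ?scalerA ?mulVf ?scale1r ?gt_eqF //.
    exact: Py.
  have A0' : A == 0 by rewrite -A0.
  move: A0'; rewrite /A psumr_eq0 // => /allP tj j /andP[_ js].
  by have /eqP -> := tj j js; rewrite scale0r.
have tA : t i + A != 0 by rewrite gt_eqF.
have -> : (t i + A)^-1 *: (t i *: y i + \sum_(j <- s) t j *: y j) =
    (t i / (t i + A)) *: y i +
    (1 - t i / (t i + A)) *: (A^-1 *: \sum_(j <- s) t j *: y j).
  rewrite scalerDr !scalerA; congr (_ *: _ + _ *: _); first by rewrite mulrC.
  by field; rewrite tA gt_eqF.
apply: P_conv; last exact: IH.
- by rewrite divr_ge0 // ltW.
- by rewrite ler_pdivrMr // mul1r lerDl ltW.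
- exact: Py.
Qed.

Lemma conv_comb (I : finType) (t : I -> R) (y : I -> X) :
  (forall i, 0 <= t i) -> \sum_i t i = 1 -> (forall i, 0 < t i -> P (y i)) ->
  P (\sum_i t i *: y i).
Proof.
move=> t0 t1 Py; have := @conv_comb_seq _ (index_enum I) t y t0 Py.
by rewrite t1 invr1 scale1r; apply.
Qed.
End Convex.

Lemma convex_setP (R : realType) (X : lmodType R) (C : set X) :
  convex_set (C : set (convex_lmodType X)) ->
  forall x y (a : R), 0 <= a -> a <= 1 -> C x -> C y -> C (a *: x + (1 - a) *: y).
Proof.
move=> convC x y a a0 a1 Cx Cy.
have a01 : Itv.spec (@Itv.num_sem R) (Itv.Real `[0%Z, 1%Z]) a.
  by rewrite /= /Itv.num_sem /= in_itv /= a0 a1 ger0_real.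
have := convC x y (Itv.mk a01); rewrite !inE; exact.
Qed.

Section MQuasiconvex.
Variables (R : realType) (X : lmodType R).
Implicit Types u v : X -> R.

Lemma m_quasiconvex_max u v : m_quasiconvex u -> m_quasiconvex v ->
  m_quasiconvex (fun x => Num.max (u x) (v x)).
Proof.
move=> [u0 [uz uq]] [v0 [vz vq]]; split; first by move=> x; rewrite le_max u0.
split=> [|x y a a0 a1]; first by rewrite uz vz maxxx.
rewrite ge_max; apply/andP; split.
  by apply: le_trans (uq x y a a0 a1) _; rewrite ge_max !le_max !lexx /= !orbT.
by apply: le_trans (vq x y a a0 a1) _; rewrite ge_max !le_max !lexx /= !orbT.
Qed.

Lemma m_quasiconvex_bigmax (I : eqType) (s : seq I) (u : I -> X -> R) :
  {in s, forall i, m_quasiconvex (u i)} ->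
  m_quasiconvex (fun x => \big[Num.max/0]_(i <- s) u i x).
Proof.
elim: s => [_|i s IH us].
  under eq_fun do rewrite big_nil.
  by do !split => // *; rewrite maxxx.
under eq_fun do rewrite big_cons.
apply: m_quasiconvex_max; first by apply: us; rewrite mem_head.
by apply: IH => j js; apply: us; rewrite inE js orbT.
Qed.

Lemma m_quasiconvexZ u (k : R) : 0 <= k -> m_quasiconvex u ->
  m_quasiconvex (fun x => k * u x).
Proof.
move=> k0 [u0 [uz uq]]; split; first by move=> x; rewrite mulr_ge0.
split=> [|x y a a0 a1]; first by rewrite uz mulr0.
by rewrite -maxr_pMr // ler_wpM2l // uq.
Qed.

(** Quasiconvexity makes the set of [z] with [u (w - z) <= b] convex. *)
Lemma m_quasiconvex_conv_comb u (I : finType) (t : I -> R) (y : I -> X) (w : X) (b : R) :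
  m_quasiconvex u -> (forall i, 0 <= t i) -> \sum_i t i = 1 ->
  (forall i, 0 < t i -> u (w - y i) <= b) -> u (w - \sum_i t i *: y i) <= b.
Proof.
move=> [u0 [uz uq]] t0 t1 ub.
apply: (@conv_comb R X [set z | u (w - z) <= b]) => // x z a a0 a1 /= ux uz'.
have -> : w - (a *: x + (1 - a) *: z) = a *: (w - x) + (1 - a) *: (w - z).
  rewrite !scalerBr addrACA -scalerDl -opprD.
  by rewrite (_ : a + (1 - a) = 1) ?scale1r //; ring.
by apply: le_trans (uq _ _ _ a0 a1) _; rewrite ge_max ux.
Qed.
End MQuasiconvex.

(** * Fixed points *)

Section FixedPoint.
Variables (R : realType) (X : topologicalLmodType R).
Variables (C : set X) (f : X -> X).
Hypotheses (C0 : C !=set0) (compC : compact C)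
  (convC : convex_set (C : set (convex_lmodType X)))
  (contf : {within C, continuous f}) (fC : f @` C `<=` C).

Lemma continuous_conv_comb n (y : 'I_n.+1 -> X) :
  continuous (fun t : 'rV[R]_n.+1 => \sum_i t ord0 i *: y i).
Proof.
apply: continuous_big => [|i _]; first exact: add_continuous.
move=> t; apply: (@continuous_comp _ (R^o : topologicalType) _
  (fun t : 'rV[R]_n.+1 => t ord0 i) (fun a => a *: y i)).
  exact: coord_continuous.
apply: (@continuous_comp _ (R^o * X)%type _ (fun a : R^o => (a, y i))
  (fun z => z.1 *: z.2)); last exact: scale_continuous.
set a0 := (X in {for X, _}).
by apply: (@cvg_pair _ _ _ _ (nbhs (a0 : R^o)) (nbhs (y i)));
  [exact: cvg_id|exact: cvg_cst].
Qed.

Lemma continuous_subr (y : X) : continuous (fun x : X => x - y).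
Proof.
move=> x; apply: (@continuous_comp _ _ _ (fun x => (x, y)) (fun z : X * X => z.1 - z.2)).
  by apply: cvg_pair; [exact: cvg_id|exact: cvg_cst].
exact: sub_continuous.
Qed.

(** [f] is continuous only within [C], so the condition [simplex t] is kept in the set: a strict
    violation at a limit point would persist at nearby points of the simplex. *)
Lemma closed_level n (y : 'I_n.+1 -> X) (z : X) (u : X -> R) (b : R) :
  (forall i, C (y i)) -> continuous u ->
  closed [set t | simplex t /\ u (f (\sum_i t ord0 i *: y i) - z) <= b].
Proof.
move=> Cy contu; pose g (t : 'rV[R]_n.+1) : X := \sum_i t ord0 i *: y i.
have gC t : simplex t -> C (g t).
  by move=> [t0 t1]; apply: (conv_comb (convex_setP convC)).
move=> t clt.
have tS : simplex t.
  apply: closed_simplex => B tB; have [s [[sS _] Bs]] := clt B tB; by exists s.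
split=> //; rewrite leNgt; apply/negP => bt.
have /subspace_continuousP/(_ _ (gC t tS)) fgt := contf.
have ut : {for f (g t), continuous (fun x => u (x - z))}.
  apply: (@continuous_comp _ _ _ (fun x => x - z) u); first exact: continuous_subr.
  exact: contu.
have /fgt : nbhs (f (g t)) [set x | b < u (x - z)].
  by apply: (ut [set r : R | b < r]); exact: lt_nbhsr.
move=> /(@continuous_conv_comb n y t) near_t.
have [s [[sS us] /= bs]] := clt _ near_t.
by have := bs (gC s sS); rewrite ltNge us.
Qed.

Lemma almost_fixed (u : X -> R) : continuous u -> m_quasiconvex u ->
  exists2 x, C x & u (f x - x) < 1.
Proof.
move=> contu mqu; have [_ [uz _]] := mqu.
pose O (y : X) := [set z | u (z - y) < 2^-1].
have [||D' D'C Ccov] := @compact_cover_compact _ C C0 compC X C O.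
- move=> y _; apply: (@open_comp _ _ (fun z => u (z - y)) [set r | r < 2^-1]).
    move=> z _; apply: (@continuous_comp _ _ _ (fun x => x - y) u).
      exact: continuous_subr.
    exact: contu.
  exact: open_lt.
- by move=> z Cz; exists z; rewrite // /O /= subrr uz invr_gt0.
have [y0 D'y0] : exists y0, y0 \in D'.
  by have [z /Ccov[y0 yD _]] := C0; exists y0.
(* [y0] shows that [D'] is nonempty, so ['I_n.+1] indexes it exactly. *)
pose n := (size (D' : seq X)).-1.
have sizeD : size (D' : seq X) = n.+1.
  have : (index y0 (D' : seq X) < size (D' : seq X))%N by rewrite index_mem.
  by rewrite /n; case: (size _).
pose y (i : 'I_n.+1) := nth y0 (D' : seq X) i.
have yC i : C (y i).
  have yD : y i \in (D' : seq X) by apply: mem_nth; rewrite sizeD.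
  by have := D'C _ yD; rewrite inE.
pose g (t : 'rV[R]_n.+1) : X := \sum_i t ord0 i *: y i.
have gC t : simplex t -> C (g t).
  by move=> [t0 t1]; apply: (conv_comb (convex_setP convC)).
pose F i := [set t | simplex t /\ u (f (g t) - y i) <= 2^-1].
have [|t tS|t tS tF] := @closed_cover_simplex R n F.
- by move=> i; exact: closed_level.
- have [|z zD zO] := Ccov (f (g t)).
    by apply: fC; exists (g t) => //; exact: gC.
  have zi : (index z (D' : seq X) < n.+1)%N by rewrite -sizeD index_mem.
  exists (Ordinal zi); split=> //; rewrite /y nth_index //; exact: ltW.
exists (g t); first exact: gC.
have [t0 t1] := tS.
apply: (@le_lt_trans _ _ 2^-1); last by rewrite invf_lt1 ?ltr1n.
by apply: m_quasiconvex_conv_comb => // i /tF[].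
Qed.

(** The factor 1/2 leaves a strict inequality at [x], which continuity within [C] extends to a
    neighbourhood. *)
Lemma separated_nbhs (u : X -> R) (x : X) : C x -> continuous u ->
  0 < u (f x - x) ->
  nbhs x [set y | C y -> u (f x - x) / 2 < u (f y - y)].
Proof.
move=> Cx contu ux.
have /subspace_continuousP/(_ _ Cx) fx := contf.
have gx : u (f y - y) @[y --> within C (nbhs x)] --> u (f x - x).
  apply: (cvg_comp (fun y => f y - y) u); last exact: contu.
  apply: (cvg_comp (fun y => (f y, y)) (fun z : X * X => z.1 - z.2)); last first.
    exact: (@sub_continuous X (f x, x)).
  by apply: cvg_pair => //=; apply: cvg_within.
apply: (gx [set r : R | _ < r]); apply: lt_nbhsr.
by rewrite ltr_pdivrMr // ltr_pMr // ltr1n.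
Qed.
End FixedPoint.

Theorem theorem4p1 (R : realType) (X : topologicalLmodType R) :
  hausdorff_space X -> quasi_point_separable X -> fixed_point_property X.
Proof.
move=> _ [L [u [contu [mqu sep]]]] C C0 compC convC f contf fC.
apply: contrapT => nofix.
(* Scaling by [2 / u l (f x - x)] gives [w] the value 2 at [f x - x], hence values above 1 near [x];
   one threshold then serves all points of [C]. Off [C], zero is a dummy value. *)
have /choice[w wP] (x : X) : exists w : X -> R, C x -> [/\ continuous w,
    m_quasiconvex w & nbhs x [set y | C y -> 1 < w (f y - y)]].
  have [Cx|] := pselect (C x); last by exists (fun=> 0).
  have [l ul] : exists l, 0 < u l (f x - x).
    apply: contrapT => nol; apply: nofix; exists x => //; apply/eqP.
    rewrite -subr_eq0; apply/eqP/sep => l; apply/eqP; rewrite eq_le.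
    have [ul0 _] := mqu l; rewrite ul0 andbT leNgt.
    by apply/negP => ul; apply: nol; exists l.
  exists (fun z => (2 / u l (f x - x)) * u l z) => _; split.
  - by move=> z; apply: cvgM; [exact: cvg_cst|exact: contu].
  - by apply: m_quasiconvexZ => //; rewrite divr_ge0 // ltW.
  - apply: filterS (separated_nbhs contf Cx (contu l) ul) => y /= uy Cy.
    by have := uy Cy; rewrite -ltr_pdivrMl ?divr_gt0 // mulr1 invf_div.
pose O x := [set y | C y -> 1 < w x (f y - y)]°.
have [||D' D'C Ccov] := @compact_cover_compact _ C C0 compC X C O.
- by move=> x _; exact: open_interior.
- by move=> x Cx; exists x => //; have [_ _] := wP x Cx.
have D'P x : x \in D' -> continuous (w x) /\ m_quasiconvex (w x).
  by move/D'C; rewrite inE => /wP[].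
pose v z := \big[Num.max/0]_(x <- D') w x z.
have [||x Cx vx] := @almost_fixed R X C f C0 compC convC contf fC v.
- rewrite /v; under eq_fun do rewrite big_seq.
  apply: continuous_big => [z|x /D'P[]//].
  by apply: (@continuous_max _ _ fst snd); [exact: cvg_fst|exact: cvg_snd].
- by apply: m_quasiconvex_bigmax => x /D'P[].
(* The cover provides [z] in [D'] with [w z (f x - x) > 1], although [w z] is at most [v] and
   [v (f x - x) < 1]. *)
have [z zD /interior_subset /(_ Cx)] := Ccov x Cx.
apply/negP; rewrite -leNgt; apply: le_trans (ltW vx).
exact: (@le_bigmax_seq _ _ _ _ _ z predT (fun i => w i (f x - x)) zD isT).
Qed.
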